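(* Let $m,\ell$ be two positive integers. If $\alpha,\beta\in G(m,\ell)$ are such that $\alpha^n=\beta^n$ for some nonzero integer $n$, then $\alpha$ and $\beta$ are conjugate in $G(m,\ell)$.
   Context: For positive integers $m,\ell$, consider letters $a_0,\ldots,a_{m-1}$, and set $a_j:=a_{j'}$ for $j\in\mathbb{Z}$, where $j'\in\{0,\ldots,m-1\}$ and $j\equiv j' \pmod m$. For $i\in\mathbb{Z}$ and $p\geq 1$ let $s(i,p)=a_ia_{i+1}\cdots a_{i+p-1}$ (a product of $p$ consecutive letters). The circular group $G(m,\ell)$ is the group with generators $a_0,\ldots,a_{m-1}$ and relations $s(i,\ell)=s(i+1,\ell)$ for all $i\in\{0,\ldots,m-1\}$. *)

(* Defs.v *)
From HB Require Import structures.
From mathcomp Require Import all_boot all_order all_algebra.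
From mathcomp Require Import boolp.

Set Implicit Arguments.
Unset Strict Implicit.
Unset Printing Implicit Defensive.

Local Open Scope group_scope.
Local Open Scope quotient_scope.

(* Words over the generators X and their formal inverses: (x, true) stands    *)
(* for x and (x, false) for x^-1.                                             *)
Definition word (X : Type) : Type := seq (X * bool).

Definition pos_word (X : Type) (s : seq X) : word X := [seq (x, true) | x <- s].

Definition inv_word (X : Type) (w : word X) : word X :=
  rev [seq (l.1, ~~ l.2) | l <- w].

(* The least congruence on words containing R and the free cancellations.     *)
Inductive word_eq (X : Type) (R : word X -> word X -> Prop) :
    word X -> word X -> Prop :=
| word_eq_rel u v : R u v -> word_eq R u v
| word_eq_cancel x b : word_eq R [:: (x, b); (x, ~~ b)] [::]
| word_eq_refl u : word_eq R u u
| word_eq_sym u v : word_eq R u v -> word_eq R v u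
| word_eq_trans u v w : word_eq R u v -> word_eq R v w -> word_eq R u w
| word_eq_cat u u' v v' :
    word_eq R u u' -> word_eq R v v' -> word_eq R (u ++ v) (u' ++ v').

(* The group < X | u = v for all u, v such that R u v >.                      *)
Section Presentation.
Context (X : choiceType) (R : word X -> word X -> Prop).

Definition word_eqb : rel (seq (X * bool)) := fun u v => `[< word_eq R u v >].

Lemma word_eqb_refl : reflexive word_eqb.
Proof. by move=> u; apply/asboolP/word_eq_refl. Qed.

Lemma word_eqb_sym : symmetric word_eqb.
Proof. by move=> u v; apply/asboolP/asboolP => /word_eq_sym. Qed.

Lemma word_eqb_trans : transitive word_eqb.
Proof.
by move=> v u w /asboolP uv /asboolP vw; apply/asboolP/(word_eq_trans uv vw).
Qed.

Canonical word_equiv := EquivRel word_eqb word_eqb_refl word_eqb_sym word_eqb_trans.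

Definition presented_group : Type := {eq_quot word_equiv}.
HB.instance Definition _ := Choice.on presented_group.

Definition word_class (w : word X) : presented_group :=
  \pi_({eq_quot word_equiv}) w.

Definition word_repr (a : presented_group) : word X :=
  repr (a : {eq_quot word_equiv}).

Lemma word_reprK : cancel word_repr word_class.
Proof. by move=> a; apply: reprK. Qed.

Lemma word_classP u v : word_class u = word_class v <-> word_eq R u v.
Proof.
split=> [/(@eqmodP _ word_equiv)/asboolP //|uv].
by apply/(@eqmodP _ word_equiv)/asboolP.
Qed.

Lemma word_repr_class w : word_eq R (word_repr (word_class w)) w.
Proof. by apply/word_classP; rewrite word_reprK. Qed.

Definition pres_mul (a b : presented_group) : presented_group :=
  word_class (word_repr a ++ word_repr b).

Definition pres_inv (a : presented_group) : presented_group :=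
  word_class (inv_word (word_repr a)).

Lemma inv_wordV w : word_eq R (inv_word w ++ w) [::].
Proof.
elim: w => [|[x b] w IHw]; first exact: word_eq_refl.
rewrite /inv_word /= rev_cons -cats1 -catA /=.
apply: word_eq_trans IHw; apply: word_eq_cat; first exact: word_eq_refl.
rewrite -[w in word_eq R _ w]cat0s -[_ :: _]/([:: (x, ~~ b); (x, b)] ++ w).
apply: word_eq_cat; last exact: word_eq_refl.
by have := word_eq_cancel R x (~~ b); rewrite negbK.
Qed.

Lemma wordVinv w : word_eq R (w ++ inv_word w) [::].
Proof.
elim: w => [|[x b] w IHw]; first exact: word_eq_refl.
rewrite /inv_word /= rev_cons -cats1 catA -cat1s.
apply: word_eq_trans (word_eq_cancel R x b).
rewrite -[[:: _; _]]/([:: (x, b)] ++ ([::] ++ [:: (x, ~~ b)])) -!catA.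
apply: word_eq_cat; first exact: word_eq_refl.
by rewrite catA; apply: word_eq_cat => //; apply: word_eq_refl.
Qed.

Lemma pres_mulE u v : pres_mul (word_class u) (word_class v) = word_class (u ++ v).
Proof. by apply/word_classP; apply: word_eq_cat; apply: word_repr_class. Qed.

Lemma pres_mulA : associative pres_mul.
Proof.
move=> a b c; rewrite -(word_reprK a) -(word_reprK b) -(word_reprK c).
by rewrite !pres_mulE catA.
Qed.

Lemma pres_mul1 : left_id (word_class [::]) pres_mul.
Proof. by move=> a; rewrite -(word_reprK a) pres_mulE. Qed.

Lemma pres_mulr1 : right_id (word_class [::]) pres_mul.
Proof. by move=> a; rewrite -(word_reprK a) pres_mulE cats0. Qed.

Lemma pres_mulV : left_inverse (word_class [::]) pres_inv pres_mul.
Proof.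
move=> a; rewrite -{2}(word_reprK a) pres_mulE.
by apply/word_classP/inv_wordV.
Qed.

Lemma pres_mulrV : right_inverse (word_class [::]) pres_inv pres_mul.
Proof.
move=> a; rewrite -{1}(word_reprK a) pres_mulE.
by apply/word_classP/wordVinv.
Qed.

HB.instance Definition _ := isGroup.Build presented_group
  pres_mulA pres_mul1 pres_mulr1 pres_mulV pres_mulrV.

Definition pres_gen (x : X) : presented_group := word_class [:: (x, true)].

Lemma word_class_cat u v : word_class (u ++ v) = word_class u * word_class v.
Proof. by rewrite -pres_mulE. Qed.

Lemma word_class_pos s : word_class (pos_word s) = \prod_(x <- s) pres_gen x.
Proof.
elim: s => [|x s IHs]; first by rewrite big_nil.
by rewrite big_cons -IHs -word_class_cat.
Qed.

Lemma word_class_invgen x : word_class [:: (x, false)] = (pres_gen x)^-1.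
Proof.
apply: (mulgI (pres_gen x)); rewrite mulgV -word_class_cat.
by apply/word_classP/(word_eq_cancel R x true).
Qed.

Definition word_eval (H : groupType) (f : X -> H) (w : word X) : H :=
  \prod_(l <- w) (if l.2 then f l.1 else (f l.1)^-1).

Lemma presented_group_lift (H : groupType) (f : X -> H) :
    (forall u v, R u v -> word_eval f u = word_eval f v) ->
  exists phi : presented_group -> H,
    [/\ {morph phi : a b / a * b}, forall x, phi (pres_gen x) = f x
      & forall psi : presented_group -> H, {morph psi : a b / a * b} ->
          (forall x, psi (pres_gen x) = f x) -> psi =1 phi].
Proof.
move=> fR; pose phi a := word_eval f (word_repr a).
have eval_eq u v : word_eq R u v -> word_eval f u = word_eval f v.
  elim=> // {u v}.
  - by move=> x []; rewrite /word_eval !big_cons big_nil /= mulg1 ?mulgV ?mulVg.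
  - by move=> u v w _ -> _ ->.
  by move=> u u' v v' _ IHu _ IHv; move: IHu IHv; rewrite /word_eval !big_cat => -> ->.
have phiE w : phi (word_class w) = word_eval f w by apply/eval_eq/word_repr_class.
exists phi; split=> [a b|x|psi psiM psi_gen a].
- by rewrite -(word_reprK a) -(word_reprK b) -word_class_cat !phiE /word_eval big_cat.
- by rewrite phiE /word_eval big_cons big_nil mulg1.
have psi1 : psi 1 = 1 by apply: (mulgI (psi 1)); rewrite -psiM !mulg1.
rewrite -(word_reprK a) phiE.
elim: (word_repr a) => [|[x b] w IHw]; first by rewrite /word_eval big_nil.
rewrite -cat1s word_class_cat psiM IHw /word_eval big_cons; congr (_ * _).
case: b => /=; first exact: psi_gen.
rewrite (word_class_invgen x) -psi_gen.
by apply: (mulgI (psi (pres_gen x))); rewrite -psiM !mulgV psi1.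
Qed.

End Presentation.

(* a_i a_(i+1) ... a_(i+p-1), with indices modulo m: the library's ordS is    *)
(* the cyclic successor i |-> i + 1 mod m on 'I_m.                            *)
Definition s_word (m : nat) (i : 'I_m) (p : nat) : word 'I_m :=
  pos_word (traject (@ordS m) i p).

Definition circular_rel (m l : nat) (u v : word 'I_m) : Prop :=
  exists i : 'I_m, u = s_word i l /\ v = s_word (ordS i) l.

Definition circular_group (m l : nat) : groupType :=
  presented_group (@circular_rel m l).

Lemma iter_ordS m (i : 'I_m) k : iter k (@ordS m) i = (i + k) %% m :> nat.
Proof.
elim: k => [|k IHk]; first by rewrite addn0 modn_small.
by rewrite iterS /= IHk -addn1 modnDml addn1 addnS.
Qed.

Definition circular_gen (m l : nat) (i : 'I_m) : circular_group m l :=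
  pres_gen (@circular_rel m l) i.

Lemma circular_genP (m l : nat) (i : 'I_m) :
  \prod_(j <- traject (@ordS m) i l) circular_gen l j
  = \prod_(j <- traject (@ordS m) (ordS i) l) circular_gen l j.
Proof.
rewrite -!word_class_pos; apply/word_classP/word_eq_rel.
by exists i.
Qed.

Definition expgz (G : groupType) (x : G) (n : int) : G :=
  match n with
  | Posz k => x ^+ k
  | Negz k => x ^- k.+1
  end.

Definition conjugate (G : groupType) (x y : G) : Prop :=
  exists g : G, y = x ^ g.

(* Main.v *)
Require Import Defs.
From HB Require Import structures.
From mathcomp Require Import all_boot all_order all_algebra.
From mathcomp Require Import algC cyclotomic zify ring.

Set Implicit Arguments.
Unset Strict Implicit.
Unset Printing Implicit Defensive.

Import GRing.Theory.
Local Open Scope ring_scope.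

(** The idea is to separate the elements of G = G(m,l) into two kinds, as one
    does for groups acting on trees, and to use a different reason for each.

    Elements as chains of arcs.  Let S(k) = a_0 a_1 ... a_(k-1), with indices
    modulo m, and let the arc from i to j be S(i)^-1 S(j): for i <= j it is
    a_i ... a_(j-1).  Arcs compose, an arc may be translated by a multiple of m,
    and when l divides j - i it is a power of the common value of the s(i,l),
    so that it may be translated arbitrarily.  Every element of G is a product
    of arcs.  In such a product, read cyclically, two consecutive arcs merge
    if one ends where the next begins modulo m, or if one has length divisible
    by l.  A product that cannot be shortened, among the conjugates of a given
    element, is therefore either a single arc whose length is divisible by m or
    by l (the element is then called elliptic), or a cyclic chain in which no
    merging is possible (lemma [chain_reduce]).

    Elliptic elements.  The degree sends every generator to 1 and the arc from
    i to j to j - i.  Two elliptic elements of the same degree are conjugate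
    ([elliptic_conjugate]); in particular an elliptic element of degree 0 is
    trivial.

    Chains without merging.  Take 2 x 2 matrices T and B with T^m = B^l = 1 and
    send a_i to T^-i B T^(i+1); this respects the relations, as s(i,l) goes to
    T^l.  A cyclic chain without merging goes to a conjugate of a
    product of matrices B^p T^g with B^p and T^g nontrivial.  If T is lower
    triangular with an entry that is linear in an indeterminate and B is upper
    triangular with constant entries, then in such a product the degree of the
    upper left entry strictly exceeds those of both entries of the last column,
    as in a ping-pong argument for the free product of two cyclic groups of
    orders m and l.  Matrices of this shape, called dominant below, are closed under products,
    and none is scalar.  An element whose image is conjugate to a dominant
    matrix is called loxodromic; so every element is elliptic or loxodromic, and
    no positive power of a loxodromic element is in the kernel of the
    representation.

    Conclusion.  Suppose that a^n = b^n with n > 0; then a and b have the same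
    degree.  If a is loxodromic, the images of a and b^-1 commute with the image
    of a^n, which is not scalar, so they commute with each other, because the
    centralizer of a nonscalar 2 x 2 matrix is commutative.  Thus (a b^-1)^n is
    in the kernel, a b^-1 is not loxodromic, hence it is elliptic of degree 0,
    and a = b.  The case where b is loxodromic is symmetric, and if both are
    elliptic, equality of the degrees makes them conjugate. *)

(** * Two by two matrices *)

Section TwoByTwo.
Context (R : idomainType).
Implicit Types A B M N P Q : 'M[R]_2.

Lemma mul2E A B i j : (A * B) i j = A i 0 * B 0 j + A i 1 * B 1 j.
Proof.
by rewrite mxE !big_ord_recl big_ord0 addr0 (_ : lift _ _ = 1) //; apply/val_inj.
Qed.

Lemma ord2_cases (i : 'I_2) : i = 0 \/ i = 1.
Proof. by case: i => [[|[|//]] lt_i]; [left | right]; apply/val_inj. Qed.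

Lemma mx2_eq A B :
  A 0 0 = B 0 0 -> A 0 1 = B 0 1 -> A 1 0 = B 1 0 -> A 1 1 = B 1 1 -> A = B.
Proof.
by move=> *; apply/matrixP=> i j; case: (ord2_cases i) (ord2_cases j) => -> [] ->.
Qed.

(** The equation C M = M C says that the vector (C01, C10, C00 - C11) is
    proportional to (M01, M10, M00 - M11), and A B = B A says that the vectors
    of A and B are proportional; distinct diagonal entries make the vector of M
    nonzero, with an explicit nonzero coordinate to divide by. *)
Lemma centralizer_comm M A B :
  M 0 0 != M 1 1 -> A * M = M * A -> B * M = M * B -> A * B = B * A.
Proof.
rewrite -subr_eq0 => M_neq0 AM BM.
have cent01 (a b d p q s : R) :
    p * b + q * d = a * q + b * s -> (a - d) * q = b * (p - s).
  by move/(canRL (addrK _)) => e; ring: e.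
have cent10 (a c d p r s : R) :
    r * a + s * c = c * p + d * r -> (a - d) * r = c * (p - s).
  by move/(canRL (addrK _)) => e; ring: e.
have cent C : C * M = M * C ->
    (M 0 0 - M 1 1) * C 0 1 = M 0 1 * (C 0 0 - C 1 1) /\
    (M 0 0 - M 1 1) * C 1 0 = M 1 0 * (C 0 0 - C 1 1).
  move=> CM; split; [apply: cent01 | apply: cent10]; rewrite -!mul2E.
    by rewrite CM.
  by rewrite CM.
have [A01 A10] := cent _ AM; have [B01 B10] := cent _ BM.
have comm (t b c p q r s p' q' r' s' : R) :
    t != 0 -> t * q = b * (p - s) -> t * r = c * (p - s) ->
    t * q' = b * (p' - s') -> t * r' = c * (p' - s') ->
  [/\ q * r' = q' * r, q * p' = q' * (p - s) + q * s' & r * p' = r' * (p - s) + r * s'].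
  move=> t0 hq hr hq' hr'; split; apply: (mulfI t0).
  - apply: (mulfI t0); transitivity (t * q * (t * r')); first by ring.
    by rewrite hq hr'; transitivity (t * q' * (t * r)); [rewrite hq' hr|]; ring.
  - by rewrite mulrDr !(mulrA t) hq hq'; ring.
  - by rewrite mulrDr !(mulrA t) hr hr'; ring.
have [e1 e2 e3] := comm _ _ _ _ _ _ _ _ _ _ _ M_neq0 A01 A10 B01 B10.
have prod (p q r s p' q' r' s' : R) : q * r' = q' * r ->
    q * p' = q' * (p - s) + q * s' -> r * p' = r' * (p - s) + r * s' ->
  [/\ p * p' + q * r' = p' * p + q' * r, p * q' + q * s' = p' * q + q' * s,
      r * p' + s * r' = r' * p + s' * r & r * q' + s * s' = r' * q + s' * s].
  by move=> h1 h2 h3; split; [ring: h1 | ring: h2 | ring: h3 | ring: h1].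
by have [] := prod _ _ _ _ _ _ _ _ e1 e2 e3; move=> *; apply: mx2_eq; rewrite !mul2E.
Qed.

Lemma conj_centralizer_comm P Q M A B :
    P * Q = 1 -> Q * P = 1 -> M 0 0 != M 1 1 ->
    A * (P * M * Q) = P * M * Q * A -> B * (P * M * Q) = P * M * Q * B ->
  A * B = B * A.
Proof.
move=> PQ QP M_neq AM BM.
have PQK X : X * P * Q = X by rewrite -mulrA PQ mulr1.
have QPK X : X * Q * P = X by rewrite -mulrA QP mulr1.
have cent C : C * (P * M * Q) = P * M * Q * C -> Q * C * P * M = M * (Q * C * P).
  move/(congr1 (fun N => Q * N * P)).
  by rewrite !mulrA QP mul1r QPK.
have /(congr1 (fun N => P * N * Q)) := centralizer_comm M_neq (cent _ AM) (cent _ BM).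
by rewrite !mulrA PQ !mul1r !PQK.
Qed.

End TwoByTwo.

(** * Dominant matrices *)

Section Dominant.
Context (F : fieldType).
Implicit Types (x y : F) (M N : 'M[{poly F}]_2).

(** The degree inequalities are weak in the lower left entry, since the products
    [upper x * lower y] have both entries of their first column of degree 1;
    this is still enough for stability under products. *)
Definition dominant M : bool :=
  [&& size (M 0%R 1%R) < size (M 0%R 0%R), size (M 1%R 1%R) < size (M 0%R 0%R)
    & size (M 1%R 0%R) <= size (M 0%R 0%R)]%N.

(** The term M00 N00 has a larger degree than M01 N10, so that it gives the degree
    of the upper left entry.  In the last column every term contains a factor
    from the last column of N or M, whose degree is strictly smaller than that
    of the upper left entry, whence strict inequalities there. *)
Lemma dominant_mul M N : dominant M -> dominant N -> dominant (M * N).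
Proof.
move=> /and3P[M01 M11 M10] /and3P[N01 N11 N10].
have M00 : (0 < size (M 0%R 0%R))%N by apply: leq_ltn_trans M01.
have N00 : (0 < size (N 0%R 0%R))%N by apply: leq_ltn_trans N01.
have mul_le (p q : {poly F}) a b : (size p <= a -> size q <= b ->
    size (p * q)%R <= (a + b).-1)%N.
  by move=> pa qb; apply: leq_trans (size_polyMleq _ _) _; lia.
have mul_lt (p q : {poly F}) a b : (0 < a -> 0 < b -> size p <= a -> size q <= b ->
    (size p < a) || (size q < b) -> size (p * q)%R < (a + b).-1)%N.
  by move=> a0 b0 pa qb ab; apply: leq_ltn_trans (size_polyMleq _ _) _; lia.
have add_lt (p q : {poly F}) n : (size p < n -> size q < n -> size (p + q)%R < n)%N.
  by move=> pn qn; apply: leq_ltn_trans (size_polyD _ _) _; rewrite gtn_max pn.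
have s00 : size ((M * N) 0 0) = (size (M 0 0) + size (N 0 0)).-1.
  have s00 : size (M 0 0 * N 0 0) = (size (M 0 0) + size (N 0 0)).-1.
    by rewrite size_mul // -size_poly_gt0.
  by rewrite mul2E size_polyDl ?s00 // mul_lt ?M01 // ltnW.
rewrite /dominant s00 !mul2E; apply/and3P; split.
- by apply: add_lt; apply: mul_lt; rewrite ?M01 ?N01 ?orbT // ltnW.
- by apply: add_lt; apply: mul_lt; rewrite ?M11 ?N01 ?orbT // ltnW.
- by apply: leq_trans (size_polyD _ _) _; rewrite geq_max !mul_le // ltnW.
Qed.

Lemma dominant_exp M n : (0 < n)%N -> dominant M -> dominant (M ^+ n).
Proof.
case: n => // n _ domM; elim: n => [|n IHn]; first by rewrite expr1.
by rewrite exprS; apply: dominant_mul.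
Qed.

Lemma dominant_diag M : dominant M -> M 0 0 != M 1 1.
Proof. by case/and3P=> _ + _; apply: contraTneq => ->; rewrite ltnn. Qed.

(** The matrices B^p and T^g of the representation, as one-parameter families:
    x and y stand for powers of roots of unity, and both families are
    multiplicative in the parameter.  The factors x - 1 and y - 1 vanish exactly
    when the matrix is the identity. *)
Definition upper x : 'M[{poly F}]_2 :=
  \matrix_(i, j) if i == 0 then if j == 0 then x%:P else (x - 1)%:P
                 else if j == 0 then 0 else 1.

Definition lower y : 'M[{poly F}]_2 :=
  \matrix_(i, j) if i == 0 then if j == 0 then 1 else 0
                 else if j == 0 then (y - 1)%:P * 'X else y%:P.

Lemma upper_mul x y : upper x * upper y = upper (x * y).
Proof. by apply: mx2_eq; rewrite mul2E !mxE /= ?(polyCB, polyCM); ring. Qed.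

Lemma lower_mul x y : lower x * lower y = lower (x * y).
Proof. by apply: mx2_eq; rewrite mul2E !mxE /= ?(polyCB, polyCM); ring. Qed.

Lemma upper1 : upper 1 = 1.
Proof. by apply: mx2_eq; rewrite !mxE /= ?subrr. Qed.

Lemma lower1 : lower 1 = 1.
Proof. by apply: mx2_eq; rewrite !mxE /= ?subrr ?mul0r. Qed.

(** The upper left entry is x + (x - 1)(y - 1)X, of degree exactly 1. *)
Lemma dominant_upper_lower x y : x != 1 -> y != 1 -> dominant (upper x * lower y).
Proof.
move=> x_neq1 y_neq1.
have x1 : x - 1 != 0 by rewrite subr_eq0.
have y1 : y - 1 != 0 by rewrite subr_eq0.
have sX (a : F) : a != 0 -> size (a%:P * 'X) = 2.
  by move=> a0; rewrite mul_polyC size_scale ?size_polyX.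
have s00 : size ((upper x * lower y) 0 0) = 2.
  rewrite mul2E !mxE /= mulr1 mulrA -polyCM addrC size_polyDl sX ?mulf_neq0 //.
  by rewrite ltnS size_polyC_leq1.
rewrite /dominant s00 !mul2E !mxE /= !mulr0 !mul0r !mul1r !add0r -polyCM sX //.
by rewrite ltnS !ltnS !size_polyC_leq1.
Qed.

End Dominant.

Local Open Scope group_scope.

(** * Generalities on presented groups, cyclic lists and roots of unity *)

Lemma expgz_eq (H : groupType) (a b : H) n : n <> Posz 0 ->
  expgz a n = expgz b n -> exists2 k, (0 < k)%N & a ^+ k = b ^+ k.
Proof.
case: n => [[//|k]|k] _ /=; first by exists k.+1.
by move/invg_inj; exists k.+1.
Qed.

Section PresentationMaps.
Context (X : choiceType) (R : word X -> word X -> Prop).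
Local Notation G := (presented_group R).

Lemma presented_group_ind (P : G -> Prop) :
    P 1 -> (forall x g, P g -> P (pres_gen R x * g)) ->
    (forall x g, P g -> P ((pres_gen R x)^-1 * g)) ->
  forall g, P g.
Proof.
move=> P1 Pgen Pinv g; rewrite -(word_reprK g).
elim: (word_repr g) => [//|[x b] w IHw]; rewrite -cat1s word_class_cat.
by case: b => /=; [apply: Pgen | rewrite word_class_invgen; apply: Pinv].
Qed.

(** The lifting property with values in the units of a ring, such as invertible
    matrices, which are not themselves packaged as a group. *)
Lemma presented_group_lift_units (A : unitRingType) (f : X -> A) :
    (forall x, f x \is a GRing.unit) ->
    (forall u v, R u v -> exists s t, [/\ u = pos_word s, v = pos_word t
       & (\prod_(x <- s) f x = \prod_(x <- t) f x)%R]) ->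
  exists phi : G -> A, [/\ phi 1 = 1%R,
    {morph phi : a b / a * b >-> (a * b)%R}
    & forall x, phi (pres_gen R x) = f x].
Proof.
move=> f_unit fR.
pose eval (w : word X) := (\prod_(i <- w) (if i.2 then f i.1 else (f i.1)^-1))%R.
have eval_pos s : eval (pos_word s) = (\prod_(x <- s) f x)%R by rewrite /eval big_map.
have eval_eq u v : word_eq R u v -> eval u = eval v.
  elim=> // {u v}.
  - by move=> u v /fR [s [t [-> -> eq_st]]]; rewrite !eval_pos.
  - move=> x b; rewrite /eval !big_cons !big_nil /= mulr1.
    by case: b; rewrite /= ?mulrV ?mulVr.
  - by move=> u v w _ -> _ ->.
  by move=> u u' v v' _ IHu _ IHv; move: IHu IHv; rewrite /eval !big_cat => -> ->.
have phiE w : eval (word_repr (word_class R w)) = eval w by apply/eval_eq/word_repr_class.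
exists (fun g => eval (word_repr g)); split=> [|a b|x].
- by rewrite phiE /eval big_nil.
- by rewrite -(word_reprK a) -(word_reprK b) -word_class_cat !phiE /eval big_cat.
- by rewrite phiE /eval big_cons big_nil mulr1.
Qed.

End PresentationMaps.

Lemma path_break (T : Type) (e : rel T) x p : ~~ path e x p ->
  exists p1 u v p2, x :: p = p1 ++ [:: u, v & p2] /\ ~~ e u v.
Proof.
elim: p x => //= y p IHp x; rewrite negb_and => /orP[exy|/IHp].
  by exists [::], x, y, p.
by case=> p1 [u [v [p2 [-> euv]]]]; exists (x :: p1), u, v, p2.
Qed.

(** When a cyclic condition fails, a rotation of the list puts the failing pair
    of neighbours in front, including the pair made of the last and the first
    item. *)
Lemma cycle_break (T : Type) (e : rel T) c : (1 < size c)%N -> ~~ cycle e c ->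
  exists c1 c2 u v c3, [/\ c = c1 ++ c2, c2 ++ c1 = [:: u, v & c3] & ~~ e u v].
Proof.
case: c => [//|x p] /= p_gt0 np; have [p1 [u [v [p2 []]]]] := path_break np.
rewrite -rcons_cons; case/lastP: p2 => [|p2 y].
  rewrite -cat_rcons cats1 => e_rcons euv.
  have xp : x :: p = rcons p1 u := congr1 fst (rcons_inj e_rcons).
  have xv : x = v := congr1 snd (rcons_inj e_rcons).
  case: p1 xp {e_rcons} => [[_ p0]|y p1 [xy p_p1]]; first by rewrite p0 in p_gt0.
  exists (x :: p1), [:: u], u, x, p1; rewrite p_p1 cats1; split=> //.
  by rewrite xv.
rewrite -!rcons_cons -rcons_cat => /rcons_inj/(congr1 fst)/= -> euv.
by exists p1, [:: u, v & p2], u, v, (p2 ++ p1).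
Qed.

Lemma prim_root_expr_neq0 (F : fieldType) n (z : F) k :
  n.-primitive_root z -> (z ^+ k != 0)%R.
Proof.
move=> z_prim; apply: expf_neq0; apply: contra_eq_neq (prim_expr_order z_prim) => ->.
by rewrite expr0n eqn0Ngt (prim_order_gt0 z_prim) eq_sym oner_neq0.
Qed.

(** * Arcs and chains *)

Section Arcs.
Context (m l : nat) (m_gt0 : (0 < m)%N).
Local Notation G := (circular_group m l).

Definition index_mod x : 'I_m := Ordinal (ltn_pmod x m_gt0).
Local Notation gen x := (circular_gen l (index_mod x)).

Definition initial (k : nat) : G := \prod_(0 <= x < k) gen x.

(** For i <= j this is a_i ... a_(j-1), and for j <= i it is the inverse of
    a_j ... a_(i-1).  Natural number endpoints suffice, since the relevant
    facts allow translation by multiples of m. *)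
Definition arc i j : G := (initial i)^-1 * initial j.

Lemma ordS_index_mod x : ordS (index_mod x) = index_mod x.+1.
Proof. by apply: val_inj; rewrite /= -addn1 modnDml addn1. Qed.

Lemma index_mod_val (i : 'I_m) : index_mod i = i.
Proof. by apply: val_inj; rewrite /= modn_small. Qed.

Lemma arcM i j k : arc i j * arc j k = arc i k.
Proof. by rewrite /arc mulgA mulgK. Qed.

Lemma arcV i j : (arc i j)^-1 = arc j i.
Proof. by rewrite /arc invgM invgK. Qed.

Lemma arcxx i : arc i i = 1.
Proof. exact: mulVg. Qed.

Lemma arcS i : arc i i.+1 = gen i.
Proof. by rewrite /arc /initial big_nat_recr //= mulKg. Qed.

Lemma arc_traject i p :
  arc i (i + p) = \prod_(j <- traject (@ordS m) (index_mod i) p) circular_gen l j.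
Proof.
elim: p i => [|p IHp] i; first by rewrite addn0 arcxx big_nil.
by rewrite /= big_cons ordS_index_mod -IHp -arcS arcM addnS addSn.
Qed.

Lemma arc_period i j k : (m %| k)%N -> arc (i + k) (j + k) = arc i j.
Proof.
move=> mk.
have base x p : arc (x + k) (x + p + k) = arc x (x + p).
  rewrite addnAC !arc_traject; congr (\prod_(y <- traject _ _ _) _).
  by apply: val_inj; rewrite /= -modnDmr (eqP mk) addn0.
have [/subnKC <-|/ltnW/subnKC <-] := leqP i j; first exact: base.
by rewrite -[LHS]arcV -[RHS]arcV base.
Qed.

(** The right-hand arc is the left-hand one translated by j - i. *)
Lemma arc_slide i j i' j' :
  i = j %[mod m] -> (i + j' = i' + j)%N -> arc i i' = arc j j'.
Proof.
have base x y x' y' : (x <= y)%N ->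
    x = y %[mod m] -> (x + y' = x' + y)%N -> arc x x' = arc y y'.
  move=> le_xy /eqP; rewrite eq_sym eqn_mod_dvd // => dvd_m e.
  have -> : y = (x + (y - x))%N by lia.
  have -> : y' = (x' + (y - x))%N by lia.
  by rewrite arc_period.
have [le_ij|/ltnW le_ji] := leqP i j; first exact: base.
by move=> eq_ij e; apply/esym; apply: base => //; lia.
Qed.

(** The defining relations of the group, for all starting points at once. *)
Lemma arc_full i : arc i (i + l) = arc 0 l.
Proof.
elim: i => [//|i <-]; rewrite !arc_traject -ordS_index_mod.
exact/esym/circular_genP.
Qed.

Lemma arc_full_mul i k : arc i (i + k * l) = arc 0 l ^+ k.
Proof.
elim: k => [|k IHk]; first by rewrite addn0 arcxx.
by rewrite expgSr -IHk -(arc_full (i + k * l)) arcM mulSn -addnA (addnC l).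
Qed.

(** Such an arc is an integral power of the common value of the arcs of length l. *)
Lemma arc_translate i j i' j' :
  i = j %[mod l] -> (i + j' = i' + j)%N -> arc i j = arc i' j'.
Proof.
have base x y x' y' : (x <= y)%N ->
    x = y %[mod l] -> (x + y' = x' + y)%N -> arc x y = arc x' y'.
  move=> le_xy /eqP; rewrite eq_sym eqn_mod_dvd // => /dvdnP [k yx] e.
  have -> : y = (x + k * l)%N by lia.
  have -> : y' = (x' + k * l)%N by lia.
  by rewrite !arc_full_mul.
have [le_ij|/ltnW le_ji] := leqP i j; first exact: base.
move=> eq_ij e; rewrite -[LHS]arcV -[RHS]arcV; congr (_^-1).
by apply: base => //; lia.
Qed.

Definition chain (c : seq (nat * nat)) : G := \prod_(u <- c) arc u.1 u.2.

(** Under the representation below, these are the elements that go to conjugates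
    of powers of B (when m divides the length) or of T (when l does). *)
Definition elliptic (g : G) : Prop :=
  exists i j h, (i = j %[mod m] \/ i = j %[mod l]) /\ g = arc i j ^ h.

Lemma chain_rot c1 c2 : chain (c2 ++ c1) = chain (c1 ++ c2) ^ chain c1.
Proof. by rewrite /chain !big_cat /= conjgE !mulgA mulVg mul1g. Qed.

Lemma chain_generates g : exists2 c, (0 < size c)%N & g = chain c.
Proof.
elim/presented_group_ind: g => [|x g [c _ ->]|x g [c _ ->]].
- by exists [:: (0, 0)%N]; rewrite // /chain big_seq1 arcxx.
- exists ((x : nat, x.+1) :: c) => //.
  by rewrite /chain big_cons arcS index_mod_val.
exists ((x.+1, x : nat) :: c) => //.
by rewrite /chain big_cons /= -(arcV x) arcS index_mod_val.
Qed.

(** In the first case, after translations by multiples of m, the second arc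
    begins where the first one ends; in the second case the first arc may be
    translated arbitrarily, and is made to end where the second one begins. *)
Lemma arc_fuse u v : u.2 = v.1 %[mod m] \/ u.1 = u.2 %[mod l] ->
  exists w, arc u.1 u.2 * arc v.1 v.2 = arc w.1 w.2.
Proof.
case: u v => [i j] [i' j'] /= [eq_m|eq_l].
  (* The translation by m * i' keeps the natural number endpoints from being
     truncated by the subtraction of i'. *)
  have le_i' : (i' <= m * i')%N by rewrite leq_pmull.
  exists (i + m * i', j + m * i' + j' - i')%N => /=.
  rewrite -[RHS](arcM _ (j + m * i')) arc_period ?dvdn_mulr //; congr (_ * _).
  by apply: arc_slide; [rewrite -modnDmr modnMr addn0 | lia].
have le_j : (j <= m * j)%N by rewrite leq_pmull.
exists (i' + m * j + i - j, j' + m * j)%N => /=.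
rewrite -[RHS](arcM _ (i' + m * j)) arc_period ?dvdn_mulr //; congr (_ * _).
by apply: arc_translate => //; lia.
Qed.

(** The negations of the two conditions under which [arc_fuse] applies: under the
    representation below they say that the powers of T between two arcs, and the
    powers of B inside them, are nontrivial. *)
Definition gap (u v : nat * nat) := u.2 != v.1 %[mod m].
Definition turning (u : nat * nat) := u.1 != u.2 %[mod l].

(** By induction on the length: any admissible merging, brought to the front by
    a rotation, gives a conjugate product with one arc less. *)
Lemma chain_reduce c : (0 < size c)%N ->
  elliptic (chain c) \/ exists c', [/\ (0 < size c')%N, cycle gap c', all turning c'
    & exists h, chain c = chain c' ^ h].
Proof.
have [n] := ubnP (size c); elim: n c => // n IHn c; rewrite ltnS => le_cn c_gt0.
have fuse c1 c2 u v c3 : c = c1 ++ c2 -> c2 ++ c1 = [:: u, v & c3] ->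
    (u.2 = v.1 %[mod m] \/ u.1 = u.2 %[mod l]) ->
  elliptic (chain c) \/ exists c', [/\ (0 < size c')%N, cycle gap c', all turning c'
    & exists h, chain c = chain c' ^ h].
  move=> c12 c21 /arc_fuse[w uv].
  have -> : chain c = chain (w :: c3) ^ (chain c1)^-1.
    apply: (canRL (conjgK _)); rewrite c12 -chain_rot c21 /chain !big_cons mulgA.
    by rewrite uv.
  have [|//|[i [j [h [ij ->]]]]|] := IHn (w :: c3).
  - by apply: leq_trans le_cn; rewrite c12 size_cat addnC -size_cat c21.
  - by left; exists i, j, (h * (chain c1)^-1); rewrite conjgM.
  case=> c' [c'_gt0 gap_c' turn_c' [h ->]]; right; exists c'; split=> //.
  by exists (h * (chain c1)^-1); rewrite conjgM.
have [c_gt1|c_le1] := ltnP 1 (size c).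
  have [gap_c|] := boolP (cycle gap c); last first.
    case/cycle_break=> // c1 [c2 [u [v [c3 [c12 c21 /negPn/eqP uv]]]]].
    by apply: (fuse _ _ _ _ _ c12 c21); left.
  have [turn_c|] := boolP (all turning c).
    by right; exists c; split=> //; exists 1; rewrite conjg1.
  case/allPn=> u u_c /negPn/eqP u12.
  case/splitPr: u_c c_gt1 fuse => c1 c2 c_gt1 fuse.
  case c21: (c2 ++ c1) => [|v c3].
    by move: c_gt1; rewrite size_cat addnC /= addSn -size_cat c21.
  by apply: (fuse c1 (u :: c2) u v c3); rewrite /= ?c21 //; right.
case: c c_gt0 c_le1 {IHn le_cn fuse} => [//|[i j] [|//]] _ _.
have [ij_m|ij_m] := eqVneq (i %% m)%N (j %% m)%N.
  by left; exists i, j, 1; rewrite conjg1 /chain big_seq1; split; [left|].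
have [ij_l|ij_l] := eqVneq (i %% l)%N (j %% l)%N.
  by left; exists i, j, 1; rewrite conjg1 /chain big_seq1; split; [right|].
right; exists [:: (i, j)]; split=> //=; last by exists 1; rewrite conjg1.
  by rewrite /gap /= eq_sym ij_m.
by rewrite /turning /= ij_l.
Qed.

(** * The degree and the matrix representation *)

(** The relations equate words of the same length l. *)
Lemma circular_degree : exists deg : G -> int,
  [/\ {morph deg : a b / a * b >-> (a + b)%R}
    & forall i j, (deg (arc i j) = j%:Z - i%:Z)%R].
Proof.
pose one : Algebra.to_multiplicative int := 1%R.
have [|deg [degM deg_gen _]] :=
    @presented_group_lift 'I_m (@circular_rel m l) (Algebra.to_multiplicative int) (fun=> one).
  move=> u v [i [-> ->]]; rewrite /word_eval /s_word /pos_word !big_map /=.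
  by rewrite !big_const_seq !count_predT !size_traject.
have deg1 : deg 1 = 1 by apply: (mulgI (deg 1)); rewrite -degM !mulg1.
exists deg; split=> [//|i j].
have deg_initial k : deg (initial k) = (k%:Z)%R.
  rewrite /initial; elim: k => [|k IHk]; first by rewrite big_geq.
  rewrite big_nat_recr //= degM IHk deg_gen.
  by rewrite -addn1 PoszD.
have : deg (initial i * arc i j) = (j%:Z)%R by rewrite mulVKg deg_initial.
rewrite degM deg_initial => <-.
(* The sum is the group law of the multiplicative copy of int. *)
by rewrite [X in (X - _)%R](_ : _ = (i%:Z + deg (arc i j))%R) // addrC addKr.
Qed.

Section Representation.
Context (F : fieldType) (xi zeta : F).
Context (xi_prim : l.-primitive_root xi) (zeta_prim : m.-primitive_root zeta).
Local Open Scope ring_scope.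

Let xi0 k : xi ^+ k != 0 := prim_root_expr_neq0 k xi_prim.
Let zeta0 k : zeta ^+ k != 0 := prim_root_expr_neq0 k zeta_prim.

(** The image T^-i B^(j-i) T^j of the arc from i to j. *)
Definition arc_mx i j : 'M[{poly F}]_2 :=
  lower (zeta ^- i) * upper (xi ^+ j / xi ^+ i) * lower (zeta ^+ j).

Lemma arc_mxM i j k : arc_mx i j * arc_mx j k = arc_mx i k.
Proof.
rewrite /arc_mx -!mulrA (mulrA (lower (zeta ^+ j))) lower_mul mulfV // lower1 mul1r.
rewrite (mulrA (upper _)) upper_mul.
suff -> : xi ^+ j / xi ^+ i * (xi ^+ k / xi ^+ j) = xi ^+ k / xi ^+ i by [].
by rewrite mulrC mulrA divfK.
Qed.

Lemma circular_group_repr : exists rho : G -> 'M[{poly F}]_2, [/\ rho 1%g = 1,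
  {morph rho : a b / (a * b)%g >-> a * b}
  & forall i j, rho (arc i j) = arc_mx i j].
Proof.
pose f (i : 'I_m) := arc_mx i i.+1.
have arc_mxii i : arc_mx i i = 1.
  by rewrite /arc_mx divff // upper1 mulr1 lower_mul mulVf // lower1.
have arc_mx_unit i j : arc_mx i j \is a GRing.unit.
  by apply/unitrP; exists (arc_mx j i); rewrite !arc_mxM !arc_mxii.
have f_index i : f (index_mod i) = arc_mx i i.+1.
  have zS : zeta ^+ (i %% m).+1 = zeta ^+ i.+1 by rewrite !exprS prim_expr_mod.
  by rewrite /f /arc_mx /= zS prim_expr_mod // !exprS !mulfK.
have f_traject i p : \prod_(j <- traject (@ordS m) (index_mod i) p) f j = arc_mx i (i + p).
  elim: p i => [|p IHp] i; first by rewrite addn0 big_nil arc_mxii.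
  by rewrite /= big_cons ordS_index_mod IHp f_index arc_mxM addSn addnS.
have arc_mx_full i : arc_mx i (i + l) = lower (zeta ^+ l).
  rewrite /arc_mx exprD (prim_expr_order xi_prim) mulr1 divff // upper1 mulr1.
  by rewrite lower_mul exprD mulKf.
have [x|u v [i [-> ->]]|rho [rho1 rhoM rho_gen]] :=
    @presented_group_lift_units _ (@circular_rel m l) _ f.
- exact: arc_mx_unit.
- exists (traject (@ordS m) i l), (traject (@ordS m) (ordS i) l); split=> //.
  by rewrite -(index_mod_val i) ordS_index_mod !f_traject !arc_mx_full.
exists rho; split=> // i j.
have rho_initial k : rho (initial k) = arc_mx 0 k.
  rewrite /initial; elim: k => [|k IHk]; first by rewrite big_geq // rho1 arc_mxii.
  by rewrite big_nat_recr //= rhoM IHk rho_gen f_index arc_mxM.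
apply: (mulrI (arc_mx_unit 0 i)).
by rewrite arc_mxM -!rho_initial -rhoM mulVKg.
Qed.

(** The last factor anticipates the first factor of the next arc, so that in a
    product of consecutive arcs these outer factors cancel, and only the powers
    of T by the gaps remain. *)
Lemma arc_mx_step u v : gap u v -> turning u ->
  exists2 M, dominant M &
    arc_mx u.1 u.2 = lower (zeta ^- u.1) * M * lower (zeta ^+ v.1).
Proof.
move=> gap_uv turn_u.
exists (upper (xi ^+ u.2 / xi ^+ u.1) * lower (zeta ^+ u.2 / zeta ^+ v.1)).
  have div_neq1 (x y : F) : x != y -> x / y != 1 by apply: contra_neq => /divr1_eq.
  apply: dominant_upper_lower; apply: div_neq1.
    by rewrite (eq_prim_root_expr xi_prim) eq_sym.
  by rewrite (eq_prim_root_expr zeta_prim).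
by rewrite -!mulrA lower_mul divfK // /arc_mx !mulrA.
Qed.

Lemma arc_mx_path u c v : path gap u (rcons c v) -> all turning (u :: c) ->
  exists2 M, dominant M &
    \prod_(w <- u :: c) arc_mx w.1 w.2 = lower (zeta ^- u.1) * M * lower (zeta ^+ v.1).
Proof.
elim: c u => [|w c IHc] u /=.
  rewrite !andbT big_seq1 => gap_uv turn_u.
  by have [M domM ->] := arc_mx_step gap_uv turn_u; exists M.
case/andP=> /arc_mx_step step path_w /andP[/step[M domM uM] turn_c].
have [N domN wN] := IHc w path_w turn_c.
exists (M * N); first exact: dominant_mul.
rewrite big_cons uM wN -!mulrA (mulrA (lower (zeta ^+ w.1))) lower_mul.
by rewrite mulfV // lower1 mul1r.
Qed.

Definition loxodromic (rho : G -> 'M[{poly F}]_2) g : Prop :=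
  exists P Q M, [/\ P * Q = 1, Q * P = 1, dominant M & rho g = P * M * Q].

(** The chain is cyclic, so the outer factors of its image are inverse to each
    other: the path lemma applies with the first arc as its own endpoint. *)
Lemma elliptic_or_loxodromic (rho : G -> 'M[{poly F}]_2) g : rho 1%g = 1 ->
    {morph rho : a b / (a * b)%g >-> a * b} ->
    (forall i j, rho (arc i j) = arc_mx i j) ->
  elliptic g \/ loxodromic rho g.
Proof.
move=> rho1 rhoM rho_arc; have [c c_gt0 ->] := chain_generates g.
have [|[d [d_gt0 gap_d turn_d [h ->]]]] := chain_reduce c_gt0; [by left|right].
have rho_chain : rho (chain d) = \prod_(w <- d) arc_mx w.1 w.2.
  by rewrite /chain (big_morph rho rhoM rho1); apply: eq_bigr.
case: d d_gt0 gap_d turn_d rho_chain => // u d _ gap_d turn_d.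
have [M domM ->] := arc_mx_path gap_d turn_d => rho_d.
exists (rho h^-1%g * lower (zeta ^- u.1)), (lower (zeta ^+ u.1) * rho h), M.
split=> //; last by rewrite conjgE !rhoM rho_d !mulrA.
- rewrite -mulrA (mulrA (lower _)) lower_mul mulVf // lower1 mul1r.
  by rewrite -rhoM mulVg.
- rewrite -mulrA (mulrA (rho _)) -rhoM mulgV rho1 mul1r.
  by rewrite lower_mul mulfV // lower1.
Qed.

End Representation.

(** * Elliptic and loxodromic elements *)

Section Roots.
Context (F : fieldType) (rho : G -> 'M[{poly F}]_2).
Context (rho1 : rho 1 = 1%R) (rhoM : {morph rho : a b / a * b >-> (a * b)%R}).

Lemma rhoX g n : rho (g ^+ n) = (rho g ^+ n)%R.
Proof. by elim: n => [|n IHn]; rewrite ?expr0 // expgS rhoM IHn exprS. Qed.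

Lemma loxodromicX g n : (0 < n)%N -> loxodromic rho g -> loxodromic rho (g ^+ n).
Proof.
move=> n_gt0 [P [Q [M [PQ QP domM gM]]]].
exists P, Q, (M ^+ n)%R; split=> //; first exact: dominant_exp.
rewrite rhoX gM; elim: n {n_gt0} => [|n IHn]; first by rewrite !expr0 mulr1.
by rewrite !exprS IHn !mulrA -(mulrA _ Q) QP mulr1.
Qed.

(** A conjugate of a dominant matrix is not the identity, whose diagonal entries
    are equal. *)
Lemma not_loxodromic1 : ~ loxodromic rho 1.
Proof.
case=> P [Q [M [PQ QP domM M1]]].
have /eqP := dominant_diag domM; apply.
have -> : M = 1%R.
  rewrite -[M]mul1r -QP -[LHS]mulr1 -QP -!mulrA (mulrA M) (mulrA P) -!mulrA.
  by rewrite (mulrA P) (mulrA (P * M)%R) -M1 rho1 mul1r.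
by rewrite !mxE.
Qed.

Lemma loxodromic_centralizer_comm g a b : loxodromic rho g ->
  commute a g -> commute b g -> (rho a * rho b = rho b * rho a)%R.
Proof.
case=> P [Q [M [PQ QP domM gM]]] ag bg.
by apply: (conj_centralizer_comm PQ QP (dominant_diag domM)); rewrite -gM -!rhoM ?ag ?bg.
Qed.

(** The images of a and b commute, so a power of a b^-1 lies in the kernel. *)
Lemma loxodromic_root a b n : (0 < n)%N -> a ^+ n = b ^+ n -> loxodromic rho a ->
  ~ loxodromic rho (a * b^-1).
Proof.
move=> n_gt0 ab lox_a /(loxodromicX n_gt0) lox.
have ca : commute a (a ^+ n) by apply/commuteX.
have cb : commute b^-1 (a ^+ n) by rewrite ab; apply/commute_sym/commuteV/commute_sym/commuteX.
have comm := loxodromic_centralizer_comm (loxodromicX n_gt0 lox_a) ca cb.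
apply: not_loxodromic1; suff e : rho ((a * b^-1) ^+ n) = rho 1.
  by case: lox => P [Q [M]]; rewrite e; exists P, Q, M.
by rewrite rhoX rhoM exprMn_comm // -!rhoX -rhoM expVgn ab mulgV.
Qed.

End Roots.

(** If l divides the common length, both arcs are equal; if m does, the arc from
    one starting point to the other conjugates them. *)
Lemma elliptic_conjugate a b : elliptic a -> elliptic b -> forall deg : G -> int,
  {morph deg : a b / a * b >-> (a + b)%R} ->
  (forall i j, (deg (arc i j) = j%:Z - i%:Z)%R) -> deg a = deg b -> conjugate a b.
Proof.
case=> i [j [h [ij ->]]] [i' [j' [h' [_ ->]]]] deg degM deg_arc.
have degJ x y : deg (x ^ y) = deg x.
  have : deg (y * x ^ y) = deg (x * y) by rewrite -conjgC.
  by rewrite !degM addrC => /addIr.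
rewrite !degJ !deg_arc => e; have eN : (i + j' = i' + j)%N by lia.
suff [k ->] : exists k, arc i' j' = arc i j ^ k.
  by exists (h^-1 * k * h'); rewrite !conjgM conjgK.
case: ij => [ij_m|ij_l]; last by exists 1; rewrite conjg1; apply/esym/arc_translate.
by exists (arc i i'); rewrite conjgE arcV [in X in _ * X](arc_slide ij_m eN) !arcM.
Qed.

Lemma elliptic_degree0 (deg : G -> int) a :
    {morph deg : a b / a * b >-> (a + b)%R} ->
    (forall i j, (deg (arc i j) = j%:Z - i%:Z)%R) ->
  elliptic a -> deg a = 0%R -> a = 1.
Proof.
move=> degM deg_arc ell_a deg_a.
have ell1 : elliptic 1.
  by exists 0%N, 0%N, 1; rewrite conjg1 arcxx; split; [left|].
have deg1 : deg 1 = 0%R by rewrite -(arcxx 0) deg_arc.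
have [g /esym/eqP] := elliptic_conjugate ell_a ell1 degM deg_arc (etrans deg_a (esym deg1)).
by rewrite conjg_eq1 => /eqP.
Qed.

End Arcs.

Theorem theorem2p16 (m l : nat) (m_gt0 : (0 < m)%N) (l_gt0 : (0 < l)%N)
  (alpha beta : circular_group m l) (n : int) (n_neq0 : n <> Posz 0) :
  expgz alpha n = expgz beta n -> conjugate alpha beta.
Proof.
case/expgz_eq=> // k k_gt0 ab.
have [deg [degM deg_arc]] := circular_degree l m_gt0.
have [xi xi_prim] := C_prim_root_exists l_gt0.
have [zeta zeta_prim] := C_prim_root_exists m_gt0.
have [rho [rho1 rhoM rho_arc]] := circular_group_repr m_gt0 xi_prim zeta_prim.
have kind g := elliptic_or_loxodromic xi_prim zeta_prim g rho1 rhoM rho_arc.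
have deg1 : deg 1 = 0%R by rewrite -(arcxx l m_gt0 0) deg_arc.
have degX g i : deg (g ^+ i) = (deg g *+ i)%R.
  by elim: i => [|i IHi]; [exact: deg1 | rewrite expgS degM IHi mulrS].
have deg_ab : deg alpha = deg beta.
  by move: (congr1 deg ab); rewrite !degX => /(Num.Theory.pmulrnI k_gt0).
have lox_eq a b : a ^+ k = b ^+ k -> deg a = deg b -> loxodromic rho a -> a = b.
  move=> eq_ab eq_deg lox_a; have not_lox := loxodromic_root rho1 rhoM k_gt0 eq_ab lox_a.
  have [ell|//] := kind (a * b^-1).
  apply: divg1_eq; apply: (elliptic_degree0 degM deg_arc ell).
  by rewrite degM eq_deg -degM mulgV.
have [ell_a|lox_a] := kind alpha; last first.
  by exists 1; rewrite conjg1 (lox_eq _ _ ab).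
have [ell_b|lox_b] := kind beta; last first.
  by exists 1; rewrite conjg1 (lox_eq _ _ (esym ab)).
exact: (elliptic_conjugate ell_a ell_b degM deg_arc).
Qed.
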